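(* Let $m,n\in\mathbb{N}$ with $m\leq n$, and let $\mathbb{G}_1\in\{(\mathbb{R}^m,+),(\mathbb{H}^m,\ast)\}$ and $\mathbb{G}_2=(\mathbb{H}^n,\ast)$ be endowed with left-invariant homogeneous distances $d_1$ and $d_2$, respectively. If $d_2$ satisfies the geodesic linearity property, then every isometric embedding $f:(\mathbb{G}_1,d_1)\to(\mathbb{G}_2,d_2)$ is of the form $f=L_g\circ A$, where $L_g$ denotes left translation by an element $g\in\mathbb{G}_2$ and $A:\mathbb{G}_1\to\mathbb{G}_2$ is a homogeneous homomorphism.
   Context: For $n\geq 1$, the Heisenberg group $\mathbb{H}^n$ is the set $\mathbb{R}^{2n}\times\mathbb{R}$ with group law $(z,t)\ast(z',t')=(z+z',\,t+t'+2\omega_n(z,z'))$, where $\omega_n(z,z')=\langle z,J_nz'\rangle$, $J_n=\begin{pmatrix}0&-E_n\\ E_n&0\end{pmatrix}$ and $E_n$ is the $n\times n$ identity matrix. The neutral element is $e=(0,0)$ and $(z,t)^{-1}=(-z,-t)$. Dilations ($\lambda>0$): $\delta_\lambda(z,t)=(\lambda z,\lambda^2t)$ on $\mathbb{H}^n$ and $\delta_\lambda(x)=\lambda x$ on $\mathbb{R}^m$. A homogeneous norm on $\mathbb{H}^n$ is a function $N:\mathbb{H}^n\to[0,\infty)$ with $N(p)=0\Leftrightarrow p=e$, $N(p^{-1})=N(p)$, $N(p\ast q)\leq N(p)+N(q)$ and $N(\delta_\lambda(p))=\lambda N(p)$ for all $p,q\in\mathbb{H}^n$, $\lambda>0$.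 A left-invariant homogeneous distance on $\mathbb{H}^n$ is a metric of the form $d_N(p,q)=N(p^{-1}\ast q)$ for a homogeneous norm $N$. On $\mathbb{R}^m$, a left-invariant homogeneous distance is a metric $d(x,y)=\|x-y\|$ induced by a norm $\|\cdot\|$ on $\mathbb{R}^m$. An isometric embedding is a distance-preserving map (not necessarily surjective). An infinite geodesic in a metric space $(X,d)$ is a map $\gamma:\mathbb{R}\to X$ with $d(\gamma(s),\gamma(s'))=|s-s'|$ for all $s,s'\in\mathbb{R}$. A homogeneous distance on $\mathbb{H}^n$ has the geodesic linearity property if every infinite geodesic is a horizontal line, i.e. for every infinite geodesic $\gamma$ there is $z_0\in\mathbb{R}^{2n}\setminus\{0\}$ with $\gamma(s)=\gamma(0)\ast(sz_0,0)$ for all $s\in\mathbb{R}$. A homogeneous homomorphism $A:\mathbb{G}_1\to\mathbb{G}_2$ is a group homomorphism with $A(\delta_\lambda(p))=\delta_\lambda(A(p))$ for all $\lambda>0$, $p\in\mathbb{G}_1$. $L_g(p)=g\ast p$. *)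

(* Defs.v *)
From HB Require Import structures.
From mathcomp Require Import all_boot all_order all_algebra.
From mathcomp Require Import ring lra reals.
Set Implicit Arguments.
Unset Strict Implicit.
Unset Printing Implicit Defensive.
Import Order.TTheory GRing.Theory Num.Theory.
Local Open Scope ring_scope.

Section Heisenberg.
Variables (R : realType) (n : nat).
Implicit Types x y z : 'cV[R]_(n + n).

Definition symplJ : 'M[R]_(n + n) := block_mx 0 (- 1%:M) 1%:M 0.

Definition dotcv (k : nat) (u v : 'cV[R]_k) : R := \sum_(i < k) u i 0 * v i 0.

Definition omega (z z' : 'cV[R]_(n + n)) : R := dotcv z (symplJ *m z').

(* A separate name, so that the Heisenberg law does not compete with the
   componentwise structures that the library puts on products. *)
Definition heis : Type := ('cV[R]_(n + n) * R)%type.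

HB.instance Definition _ := Choice.on heis.

Definition heis_mul (p q : heis) : heis :=
  (p.1 + q.1, p.2 + q.2 + 2 * omega p.1 q.1).
Definition heis_one : heis := (0, 0).
Definition heis_inv (p : heis) : heis := (- p.1, - p.2).
Definition heis_dil (l : R) (p : heis) : heis := (l *: p.1, l ^+ 2 * p.2).

Lemma dotcvE k (u v : 'cV[R]_k) : dotcv u v = (u^T *m v) 0 0.
Proof. by rewrite mxE; apply: eq_bigr => i _; rewrite mxE. Qed.

Lemma omegaE z z' : omega z z' = (z^T *m (symplJ *m z')) 0 0.
Proof. exact: dotcvE. Qed.

Lemma omegaDl x y z : omega (x + y) z = omega x z + omega y z.
Proof. by rewrite !omegaE linearD mulmxDl mxE. Qed.

Lemma omegaDr x y z : omega x (y + z) = omega x y + omega x z.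
Proof. by rewrite !omegaE !mulmxDr mxE. Qed.

Lemma omega0l x : omega 0 x = 0.
Proof. by rewrite omegaE trmx0 mul0mx mxE. Qed.

Lemma omega0r x : omega x 0 = 0.
Proof. by rewrite omegaE !mulmx0 mxE. Qed.

Lemma omegaNl x y : omega (- x) y = - omega x y.
Proof. by rewrite !omegaE linearN mulNmx mxE. Qed.

Lemma omegaNr x y : omega x (- y) = - omega x y.
Proof. by rewrite !omegaE !mulmxN mxE. Qed.

Lemma tr_symplJ : symplJ^T = - symplJ.
Proof.
by rewrite /symplJ tr_block_mx opp_block_mx linearN /= !trmx0 trmx1 !oppr0 opprK.
Qed.

Lemma omegaC x y : omega x y = - omega y x.
Proof.
rewrite !omegaE -[in LHS](trmxK (x^T *m _)) mxE !trmx_mul trmxK tr_symplJ.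
by rewrite -mulmxA mulNmx mulmxN mxE.
Qed.

Lemma omega_diag x : omega x x = 0.
Proof. have := omegaC x x; lra. Qed.

Lemma heis_mulA : associative heis_mul.
Proof.
move=> [x a] [y b] [z c]; rewrite /heis_mul /= omegaDl omegaDr addrA.
by congr (_, _); ring.
Qed.

Lemma heis_mul1 : left_id heis_one heis_mul.
Proof. by case=> z t; rewrite /heis_mul /= omega0l mulr0 addr0 !add0r. Qed.

Lemma heis_mulr1 : right_id heis_one heis_mul.
Proof. by case=> z t; rewrite /heis_mul /= omega0r mulr0 !addr0. Qed.

Lemma heis_mulV : left_inverse heis_one heis_inv heis_mul.
Proof.
by case=> z t; rewrite /heis_mul /= omegaNl omega_diag oppr0 mulr0 addr0 !addNr.
Qed.

Lemma heis_mulrV : right_inverse heis_one heis_inv heis_mul.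
Proof.
by case=> z t; rewrite /heis_mul /= omegaNr omega_diag oppr0 mulr0 addr0 !addrN.
Qed.

HB.instance Definition _ := isGroup.Build heis
  heis_mulA heis_mul1 heis_mulr1 heis_mulV heis_mulrV.

Record homogeneous_norm (N : heis -> R) : Prop := HomogeneousNorm {
  hnorm_ge0 : forall p, 0 <= N p;
  hnorm_eq0 : forall p, N p = 0 <-> p = 1%g;
  hnormV : forall p, N (p^-1)%g = N p;
  hnormM : forall p q, N (p * q)%g <= N p + N q;
  hnorm_dil : forall (l : R) p, 0 < l -> N (heis_dil l p) = l * N p
}.

Definition heis_homogeneous_distance (d : heis -> heis -> R) : Prop :=
  exists2 N, homogeneous_norm N & forall p q, d p q = N (p^-1 * q)%g.

Definition infinite_geodesic (X : Type) (d : X -> X -> R) (gamma : R -> X) : Prop :=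
  forall s s', d (gamma s) (gamma s') = `|s - s'|.

Definition geodesic_linearity (d : heis -> heis -> R) : Prop :=
  forall gamma, infinite_geodesic d gamma ->
  exists2 z0 : 'cV[R]_(n + n), z0 != 0 &
    forall s, gamma s = (gamma 0 * ((s *: z0, 0) : heis))%g.

End Heisenberg.

Section Euclidean.
Variables (R : realType) (m : nat).

(* [to_multiplicative] turns addition into the product of a [groupType]. *)
Definition euc : Type := Algebra.to_multiplicative 'cV[R]_m.

HB.instance Definition _ := Group.on euc.

Definition euc_dil (l : R) (x : euc) : euc := l *: (x : 'cV[R]_m).

Record is_norm (N : 'cV[R]_m -> R) : Prop := IsNorm {
  is_norm_ge0 : forall x, 0 <= N x;
  is_norm_eq0 : forall x, N x = 0 <-> x = 0;
  is_normD : forall x y, N (x + y) <= N x + N y;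
  is_normZ : forall a x, N (a *: x) = `|a| * N x
}.

Definition euc_homogeneous_distance (d : euc -> euc -> R) : Prop :=
  exists2 N, is_norm N & forall x y : 'cV[R]_m, d x y = N (x - y).

End Euclidean.

Definition isometric_embedding (R : realType) (X Y : Type)
    (dX : X -> X -> R) (dY : Y -> Y -> R) (f : X -> Y) : Prop :=
  forall x y, dY (f x) (f y) = dX x y.

Definition homogeneous_hom (R : realType) (G1 G2 : groupType)
    (dil1 : R -> G1 -> G1) (dil2 : R -> G2 -> G2) (A : G1 -> G2) : Prop :=
  {morph A : p q / (p * q)%g} /\
  forall (l : R) (p : G1), 0 < l -> A (dil1 l p) = dil2 l (A p).

Definition ltrans (G : groupType) (g p : G) : G := (g * p)%g.

(* Main.v *)
Require Import Defs.
From mathcomp Require Import all_boot all_order all_algebra.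
From mathcomp Require Import ring lra boolp reals.

(** The proof compares horizontal lines in the source with their images.

    In either source group, the line [s |-> p * s v] with nonzero horizontal
    direction [v] is, up to its constant speed, an infinite
    geodesic, so by geodesic linearity [f] sends it to a horizontal line
    [s |-> f p * (s w, 0)] ([geodesic_line]).  A priori [w] depends on the
    base point [p].  But two lines with the same direction [v], started at [p]
    and at [q], separate sublinearly: their distance is constant in the
    Euclidean case and [O(sqrt s)] in the Heisenberg case, where conjugation by
    [(s v, 0)] only moves the central coordinate, by an amount linear in [s].
    The image lines separate at asymptotic speed at least [N (w' - w, 0)], as a
    homogeneous norm dominates its horizontal part: [N (z, 0) <= N (z, t)]
    ([hnorm_horizontal_le]).  Hence [w = w'] ([hnorm_sublinear_eq]), and
    [w] depends on [v] alone ([isometry_along]).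

    After a left translation that makes [f] fix the neutral element, this says
    that [f (p * h) = f p * f h] for every horizontal [h], compatibly with
    dilations.  The elements [h] with this property are closed under products
    ([dil_affineM]), and horizontal elements generate the source group: this is
    trivial for the Euclidean group, and in the Heisenberg group every central
    element is a product of three horizontal ones ([heis_horizontal_decomp]). *)

(** * Horizontal elements of the Heisenberg group *)

Section HeisenbergNorm.
Local Open Scope ring_scope.
Import Order.TTheory GRing.Theory Num.Theory.
Set Implicit Arguments.
Unset Strict Implicit.
Variables (R : realType) (n : nat).
Implicit Types (z v w : 'cV[R]_(n + n)) (t s r l : R) (p q : heis R n).

Definition horizontal z : heis R n := (z, 0).
Arguments horizontal z%_R.

Lemma omegaZl l z w : omega (l *: z) w = l * omega z w.
Proof. by rewrite !omegaE linearZ /= -scalemxAl mxE. Qed.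

Lemma omegaZr l z w : omega z (l *: w) = l * omega z w.
Proof. by rewrite omegaC omegaZl omegaC mulrN opprK. Qed.

Lemma heis_mulE z t w s :
  (((z, t) : heis R n) * ((w, s) : heis R n))%g =
  (z + w, t + s + 2 * omega z w).
Proof. by []. Qed.

Lemma heis_invE z t : ((z, t) : heis R n)^-1%g = (- z, - t).
Proof. by []. Qed.

Lemma heis_dil1 p : heis_dil 1 p = p.
Proof. by case: p => z t; rewrite /heis_dil /= scale1r expr1n mul1r. Qed.

Lemma heis_dilM l p q : heis_dil l (p * q)%g = (heis_dil l p * heis_dil l q)%g.
Proof.
case: p q => [z t] [w s]; rewrite /heis_dil !heis_mulE /= omegaZl omegaZr.
by rewrite scalerDr; congr (_, _); ring.
Qed.

Lemma heis_expgE z t k :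
  (((z, t) : heis R n) ^+ k)%g = (k%:R *: z, k%:R * t).
Proof.
elim: k => [|k IHk]; first by rewrite expg0 scale0r mul0r.
rewrite expgS IHk heis_mulE omegaZr omega_diag mulr0 mulr0 addr0.
by rewrite mulrS scalerDl scale1r mulrDl mul1r.
Qed.

(** Conjugating by [(s v, 0)] adds to the central coordinate a term linear in
    [s], hence of norm [O(sqrt s)]: this is why parallel horizontal lines
    diverge sublinearly. *)
Lemma heis_horizontal_conj v z t s :
  ((horizontal (s *: v))^-1 * ((z, t) : heis R n) * horizontal (s *: v))%g =
  (((z, t) : heis R n) * ((0, s * (4 * omega z v))%R : heis R n))%g.
Proof.
rewrite heis_invE !heis_mulE omegaNl omegaZl omegaDl omegaNl omegaZl !omegaZr.
rewrite omega_diag omega0r [omega v z]omegaC addr0 /=; congr (_, _); last by ring.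
by rewrite addrAC addNr add0r addr0.
Qed.

(** The symplectic form is nonzero as soon as [0 < n], so every central element
    is [(x, 0) * (y, 0) * (- (x + y), 0)] with [omega x y = t / 2]. *)
Lemma heis_horizontal_decomp (hn : (0 < n)%N) p :
  exists x y, p = (horizontal p.1 *
    (horizontal x * horizontal y * horizontal (- (x + y))))%g.
Proof.
case: p => z t; pose i := Ordinal hn.
pose e : 'cV[R]_(n + n) := delta_mx (lshift n i) 0.
pose e' : 'cV[R]_(n + n) := delta_mx (rshift n i) 0.
have ee' : omega e e' = -1.
  rewrite /omega /dotcv (bigD1 (lshift n i)) //= big1 ?addr0.
    rewrite /e' -colE [col _ _ _ _]mxE /symplJ block_mxEur.
    by rewrite !mxE !eqxx mul1r.
  by move=> j ji; rewrite /e !mxE (negbTE ji) mul0r.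
exists ((- t / 2) *: e), e'; rewrite /= !heis_mulE omegaNr omega_diag.
rewrite omegaZl ee' subrr addr0 omega0r addr0 /=; congr (_, _); by field.
Qed.

(** * Homogeneous norms on the Heisenberg group *)

Variables (N : heis R n -> R) (hN : homogeneous_norm N).

Lemma hnorm1 : N 1%g = 0.
Proof. exact/(hnorm_eq0 hN). Qed.

Lemma hnorm_expg p k : N (p ^+ k)%g <= k%:R * N p.
Proof.
elim: k => [|k IHk]; first by rewrite expg0 hnorm1 mul0r.
rewrite expgS; apply: le_trans (hnormM hN _ _) _.
by rewrite mulrS mulrDl mul1r lerD2l.
Qed.

Lemma hnorm_center l t : 0 < l ->
  N ((0, l ^+ 2 * t) : heis R n) = l * N ((0, t) : heis R n).
Proof. by move=> l0; rewrite -(hnorm_dil hN _ l0) /heis_dil /= scaler0. Qed.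

(** The [k]-th power of [(z, t)] is the dilation by [k] of [(z, t / k)], and
    powers satisfy the triangle inequality, so dividing the central coordinate
    by [k] does not increase the norm.  As [k] grows, the error made by
    replacing [t / k] with [0] vanishes like [1 / sqrt k]; restricting to
    squares [k = j ^ 2] makes this a dilation by [1 / j]. *)
Lemma hnorm_horizontal_le z t : N (horizontal z) <= N ((z, t) : heis R n).
Proof.
have shrink k : (0 < k)%N ->
    N ((z, t / k%:R) : heis R n) <= N ((z, t) : heis R n).
  move=> k0; have k0R : 0 < k%:R :> R by rewrite ltr0n.
  rewrite -(ler_pM2l k0R) -(hnorm_dil hN _ k0R).
  apply: le_trans (hnorm_expg _ _); rewrite heis_expgE /heis_dil /=.
  suff -> : k%:R ^+ 2 * (t / k%:R) = k%:R * t by [].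
  by field; rewrite gt_eqF.
have approx j : (0 < j)%N ->
    N (horizontal z) <= N ((z, t) : heis R n) + N ((0, - t) : heis R n) / j%:R.
  move=> j0; have j0R : 0 < j%:R :> R by rewrite ltr0n.
  have -> : horizontal z = (((z, t / (j ^ 2)%:R)%R : heis R n) *
      ((0, j%:R ^-1 ^+ 2 * (- t))%R : heis R n))%g.
    rewrite heis_mulE omega0r addr0 mulr0 addr0 natrX; congr (_, _).
    by field; rewrite gt_eqF.
  apply: le_trans (hnormM hN _ _) _; apply: lerD.
    by apply: shrink; rewrite expn_gt0 j0.
  by rewrite hnorm_center ?invr_gt0// mulrC.
rewrite leNgt; apply/negP => gap.
set e := N (horizontal z) - N ((z, t) : heis R n).
have e0 : 0 < e by rewrite subr_gt0.
set b := N ((0, - t) : heis R n).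
have b0 : 0 <= b / e by apply: divr_ge0 (ltW e0); exact: hnorm_ge0 hN _.
have /andP[_ hj] := truncn_itv b0.
have := approx _ (ltn0Sn (Num.truncn (b / e))).
set j := (Num.truncn (b / e)).+1; rewrite -/b => hle.
have j0 : 0 < j%:R :> R by rewrite ltr0n.
move: hj; rewrite -/j ltr_pdivrMr// mulrC -ltr_pdivrMr// ltNge.
by rewrite /e lerBlDl hle.
Qed.

Lemma hnorm_horizontalD z w :
  N (horizontal (z + w)) <= N (horizontal z) + N (horizontal w).
Proof.
apply: le_trans (hnormM hN _ _); rewrite heis_mulE.
exact: hnorm_horizontal_le.
Qed.

Lemma hnorm_horizontalZ l z :
  N (horizontal (l *: z)) = `|l| * N (horizontal z).
Proof.
have pos s : 0 < s -> N (horizontal (s *: z)) = s * N (horizontal z).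
  by move=> s0; rewrite -(hnorm_dil hN _ s0) /heis_dil /= mulr0.
case: (ltgtP l 0) => [l0|l0|->].
- rewrite ltr0_norm // -pos ?oppr_gt0// -(hnormV hN) heis_invE oppr0.
  by rewrite scaleNr.
- by rewrite gtr0_norm // pos.
- by rewrite scale0r normr0 mul0r; exact: hnorm1.
Qed.

(** Along [s = r ^ 2] the horizontal part of the displacement is
    [r ^ 2 *: (w' - w)] up to a constant, so its norm would grow like [r ^ 2],
    faster than the bound, unless [w = w']. *)
Lemma hnorm_sublinear_eq p w w' (C D : R) :
  (forall r, 0 < r -> N ((horizontal (r ^+ 2 *: w))^-1 * p *
     horizontal (r ^+ 2 *: w'))%g <= C + D * r) ->
  w = w'.
Proof.
move=> bound; set a := N (horizontal (w' - w)).
case: p bound => z t bound; set K := C + N (horizontal (- z)).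
have grow r : 0 < r -> r ^+ 2 * a <= K + D * r.
  move=> r0; have := bound r r0; rewrite heis_invE !heis_mulE => hr.
  have := le_trans (hnorm_horizontal_le _ _) hr => {}hr.
  have -> : r ^+ 2 * a = N (horizontal
      ((- (r ^+ 2 *: w) + z + r ^+ 2 *: w') + (- z))).
    rewrite [r ^+ 2 * a](_ : _ = N (horizontal (r ^+ 2 *: (w' - w)))); last first.
      by rewrite hnorm_horizontalZ ger0_norm ?sqr_ge0.
    congr (N (horizontal _)); rewrite scalerBr.
    by apply/matrixP => i j; rewrite !mxE; ring.
  apply: le_trans (hnorm_horizontalD _ _) _.
  by rewrite /K [leRHS]addrAC lerD2r.
have : a = 0.
  apply/eqP; rewrite eq_le (hnorm_ge0 hN) andbT leNgt; apply/negP => a0.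
  (* At such an [r] the term [r * (r * a)] exceeds [r * `|K| + r * `|D|]. *)
  have [r r1 ra] : exists2 r, 1 <= r & r * a = a + (`|K| + `|D|).
    exists (1 + (`|K| + `|D|) / a); last by field; rewrite gt_eqF.
    by rewrite lerDl divr_ge0 ?addr_ge0// ltW.
  have := grow r (lt_le_trans ltr01 r1).
  rewrite expr2 -mulrA ra leNgt => /negP; apply.
  rewrite !mulrDr.
  have h1 : K <= r * `|K|.
    by apply: le_trans (ler_norm K) _; rewrite ler_peMl.
  have h2 : D * r <= r * `|D|.
    by rewrite mulrC ler_wpM2l ?ler_norm// (le_trans ler01).
  have h3 : 0 < r * a by rewrite mulr_gt0// (lt_le_trans ltr01).
  lra.
by move=> /(hnorm_eq0 hN) [] /eqP; rewrite subr_eq0 => /eqP.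
Qed.

End HeisenbergNorm.

(** * Isometric embeddings along one-parameter subgroups *)

Section Isometries.
Local Open Scope ring_scope.
Import Order.TTheory GRing.Theory Num.Theory.
Set Implicit Arguments.
Unset Strict Implicit.
Variables (R : realType) (n : nat).
Variables (d2 : heis R n -> heis R n -> R).
Hypothesis hd2 : heis_homogeneous_distance d2.
Hypothesis hgl : geodesic_linearity d2.

Lemma geodesic_line (c : R) (gamma : R -> heis R n) :
  0 < c -> (forall s s', d2 (gamma s) (gamma s') = c * `|s - s'|) ->
  exists w, forall s, gamma s = (gamma 0%R * horizontal (s *: w))%g.
Proof.
move=> c0 hgamma; have [|z _ hz] := hgl (gamma := fun s => gamma (s / c)).
  move=> s s'; rewrite hgamma -mulrBl normrM normfV (gtr0_norm c0).
  by field; rewrite gt_eqF.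
exists (c *: z) => s; have := hz (c * s).
rewrite mul0r (mulrC c) mulfK ?gt_eqF// => ->.
by rewrite scalerA.
Qed.

(** The direction [w] is the same for all base points because the two lines
    through [p] and [q] diverge sublinearly; time is parametrised by [r ^+ 2]
    so that sublinear growth [sqrt s] becomes the linear bound [D * r]. *)
Lemma isometry_along (G : groupType) (d1 : G -> G -> R) (f : G -> heis R n)
    (sigma : R -> G) (c : R) :
  isometric_embedding d1 d2 f -> 0 < c -> sigma 0%R = 1%g ->
  (forall p s s', d1 (p * sigma s)%g (p * sigma s')%g = c * `|s - s'|) ->
  (forall p q, exists C D, forall r, 0 < r ->
     d1 (p * sigma (r ^+ 2)%R)%g (q * sigma (r ^+ 2)%R)%g <= C + D * r) ->
  exists w, forall p s, f (p * sigma s)%g = (f p * horizontal (s *: w))%g.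
Proof.
move=> fiso c0 sigma0 speed diverge; have [N hN d2E] := hd2.
have line p : exists w, forall s,
    f (p * sigma s)%g = (f p * horizontal (s *: w))%g.
  have [|w hw] := @geodesic_line c (fun s => f (p * sigma s)%g) c0.
    by move=> s s'; rewrite fiso speed.
  by exists w => s; rewrite hw sigma0 mulg1.
have [w hw] := line 1%g; exists w => p s.
have [w' hw'] := line p; rewrite hw'.
suff -> : w' = w by [].
have [C [D bound]] := diverge p 1%g.
apply: (hnorm_sublinear_eq hN (p := ((f p)^-1 * f 1)%g) (C := C) (D := D)) => r r0.
by have := bound r r0; rewrite -fiso hw hw' d2E invgM !mulgA.
Qed.

(** * From generators to the whole group *)

(** Quantifying over all base points and all dilates at once makes the property
    stable under products of [h]'s without normalising [f 1]; it then encodes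
    multiplicativity (take [l = 1]) and homogeneity (take [p = 1]) together. *)
Definition dil_affine (G : groupType) (dil : R -> G -> G) (f : G -> heis R n)
    (h : G) : Prop :=
  exists a, forall l p, 0 < l -> f (p * dil l h)%g = (f p * heis_dil l a)%g.

Lemma dil_affineM (G : groupType) (dil : R -> G -> G) (f : G -> heis R n)
    (h k : G) :
  (forall l, {morph dil l : p q / (p * q)%g}) ->
  dil_affine dil f h -> dil_affine dil f k -> dil_affine dil f (h * k)%g.
Proof.
move=> dilM [a ha] [b hb]; exists (a * b)%g => l p l0.
by rewrite dilM heis_dilM !mulgA hb// ha.
Qed.

Lemma dil_affine_ltrans (G : groupType) (dil : R -> G -> G) (f : G -> heis R n) :
  (forall p, dil 1 p = p) -> (forall h, dil_affine dil f h) ->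
  exists g A, homogeneous_hom dil (@heis_dil R n) A /\ f = ltrans g \o A.
Proof.
move=> dil1 faff; exists (f 1%g), (fun p => (f 1)^-1 * f p)%g.
split; last by apply/funext => p; rewrite /ltrans /= mulVKg.
have AE h a : (forall l p, 0 < l -> f (p * dil l h)%g = (f p * heis_dil l a)%g) ->
    ((f 1)^-1 * f h)%g = a.
  by move=> ha; have := ha 1 1%g ltr01; rewrite dil1 heis_dil1 mul1g => ->; rewrite mulKg.
split=> [p q|l p l0].
  have [b hb] := faff q; rewrite (AE _ _ hb).
  by have := hb 1 p ltr01; rewrite dil1 heis_dil1 => ->; rewrite mulgA.
have [a ha] := faff p; rewrite (AE _ _ ha).
by have := ha l 1%g l0; rewrite mul1g => ->; rewrite mulKg.
Qed.

Lemma isometry_along_dil_affine (G : groupType) (dil : R -> G -> G)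
    (f : G -> heis R n) (h : G) w :
  (forall p l, f (p * dil l h)%g = (f p * horizontal (l *: w))%g) ->
  dil_affine dil f h.
Proof.
move=> hw; exists (horizontal w) => l p _.
by rewrite hw /heis_dil /= mulr0.
Qed.

(** * The Euclidean and Heisenberg sources *)

Lemma euc_isometry_dil_affine m (d1 : euc R m -> euc R m -> R)
    (f : euc R m -> heis R n) :
  euc_homogeneous_distance d1 -> isometric_embedding d1 d2 f ->
  forall h, dil_affine (@euc_dil R m) f h.
Proof.
move=> [N hN d1E] fiso h.
have eucE (p q : 'cV[R]_m) : ((p : euc R m) * q)%g = p + q by [].
have [h0|hn0] := eqVneq (h : 'cV[R]_m) 0.
  apply: (isometry_along_dil_affine (w := 0)) => p l.
  have -> : euc_dil l h = 1%g by rewrite /euc_dil h0 scaler0.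
  by rewrite scaler0 !mulg1.
have c0 : 0 < N h.
  rewrite lt_neqAle is_norm_ge0// andbT eq_sym.
  by apply: contra_neq hn0 => /(is_norm_eq0 hN).
have [|p s s'|p q|w hw] := isometry_along (sigma := fun s => euc_dil s h) fiso c0.
- by rewrite /euc_dil scale0r.
- rewrite !eucE d1E /euc_dil opprD addrACA subrr add0r -scalerBl.
  by rewrite (is_normZ hN) mulrC.
- exists (d1 p q), 0 => r _.
  by rewrite !eucE !d1E /euc_dil opprD addrACA subrr addr0 mul0r addr0.
exact: isometry_along_dil_affine hw.
Qed.

Lemma heis_isometry_horizontal m (d1 : heis R m -> heis R m -> R)
    (f : heis R m -> heis R n) :
  heis_homogeneous_distance d1 -> isometric_embedding d1 d2 f ->
  forall v, dil_affine (@heis_dil R m) f (horizontal v).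
Proof.
move=> [N hN d1E] fiso v.
have dilE l : heis_dil l (horizontal v) = horizontal (l *: v).
  by rewrite /heis_dil /= mulr0.
have [->|vn0] := eqVneq v 0.
  apply: (isometry_along_dil_affine (w := 0)) => p l.
  by rewrite /heis_dil /= !scaler0 mulr0 !mulg1.
have c0 : 0 < N (horizontal v).
  rewrite lt_neqAle (hnorm_ge0 hN) andbT eq_sym.
  by apply: contra_neq vn0 => /(hnorm_eq0 hN) [].
have [|p s s'|p q|w hw] := isometry_along
    (sigma := fun s => heis_dil s (horizontal v)) fiso c0.
- by rewrite dilE scale0r.
- rewrite d1E invgM !dilE !mulgA mulgVK heis_invE oppr0 heis_mulE omegaNl.
  rewrite omegaZl omegaZr omega_diag !mulr0 oppr0 mulr0 !addr0 -scaleNr -scalerDl.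
  by rewrite hnorm_horizontalZ// mulrC addrC distrC.
- case E : (p^-1 * q)%g => [z t].
  exists (N (p^-1 * q)%g), (N ((0, 4 * omega z v) : heis R m)) => r r0.
  rewrite d1E invgM !dilE mulgA -(mulgA _ p^-1%g) E heis_horizontal_conj.
  by apply: le_trans (hnormM hN _ _) _; rewrite hnorm_center// mulrC.
exact: isometry_along_dil_affine hw.
Qed.

Lemma heis_isometry_dil_affine m (d1 : heis R m -> heis R m -> R)
    (f : heis R m -> heis R n) :
  (0 < m)%N -> heis_homogeneous_distance d1 -> isometric_embedding d1 d2 f ->
  forall h, dil_affine (@heis_dil R m) f h.
Proof.
move=> hm hd1 fiso h; have [x [y ->]] := heis_horizontal_decomp hm h.
by do !(apply: dil_affineM; first exact: heis_dilM);
   exact: heis_isometry_horizontal hd1 fiso _.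
Qed.

End Isometries.

Theorem theorem4p1 (R : realType) (m n : nat) (hm : (0 < m)%N) (hmn : (m <= n)%N)
    (d2 : heis R n -> heis R n -> R)
    (hd2 : heis_homogeneous_distance d2)
    (hgl : geodesic_linearity d2) :
  (forall d1 : euc R m -> euc R m -> R, euc_homogeneous_distance d1 ->
    forall f : euc R m -> heis R n, isometric_embedding d1 d2 f ->
    exists (g : heis R n) (A : euc R m -> heis R n),
      homogeneous_hom (@euc_dil R m) (@heis_dil R n) A /\ f = ltrans g \o A)
  /\
  (forall d1 : heis R m -> heis R m -> R, heis_homogeneous_distance d1 ->
    forall f : heis R m -> heis R n, isometric_embedding d1 d2 f ->
    exists (g : heis R n) (A : heis R m -> heis R n),
      homogeneous_hom (@heis_dil R m) (@heis_dil R n) A /\ f = ltrans g \o A).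
Proof.
split=> d1 hd1 f fiso; apply: dil_affine_ltrans.
- by move=> p; rewrite /euc_dil GRing.scale1r.
- exact: euc_isometry_dil_affine hd2 hgl _ _ _ hd1 fiso.
- exact: heis_dil1.
- exact: heis_isometry_dil_affine hd2 hgl _ _ _ hm hd1 fiso.
Qed.
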